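(* For every configuration $C=p_r\dots p_s$ of g-2PATH, \[\mathrm{mft}_{\text{g-2PATH}}(C)\le \tilde T:=\min_{r\le i\le 0\le j\le s}\max\{-2i+j+g(i,j),\ 2j-i+f(i,j)\}.\]
   Context: Positions are elements of $\mathbb{Z}^2$; with $\epsilon_0=(1,0),\epsilon_1=(0,1),\epsilon_2=(-1,0),\epsilon_3=(0,-1)$, positions $p,p'$ are adjacent if $p'-p$ is some $\epsilon_i$. A configuration of g-2PATH is a sequence $C=p_rp_{r+1}\dots p_s$ ($r\le0\le s$) of positions with $p_0=(0,0)$ (the general), consecutive positions adjacent, all positions distinct, and $p_l,p_m$ not adjacent whenever $|l-m|\ge2$; it is identified with its set of positions. For $p\in C$, $\mathrm{bc}_C(p)=(b_0,\dots,b_3)\in\{0,1\}^4$ with $b_i=1$ iff $p+\epsilon_i\in C$. Firing squad model (boundary-sensitive): a finite automaton $A$ has a finite state set containing a quiescent state $\mathrm{Q}$, general states $\mathrm{G}_0,\dots,\mathrm{G}_{m-1}$, a set $\mathcal F$ of firing states with $\mathrm{Q}\notin\mathcal F$, a map $\tau:\{0,1\}^4\to\{0,\dots,m-1\}$, and a transition function giving the next state from the current state and the states of the four neighbours $p+\epsilon_i$ (the symbol $\#$ if there is no node there), with the requirement that a node in state $\mathrm{Q}$ whose four inputs all lie in $\{\mathrm{Q},\#\}$ stays in $\mathrm{Q}$. Placing a copy of $A$ at every position of a configuration $C$, at time $0$ the node $(0,0)$ is in state $\mathrm{G}_{\tau(\mathrm{bc}_C((0,0)))}$ and all other nodes are in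 $\mathrm{Q}$; all nodes update synchronously. $A$ is a solution of g-2PATH if for every configuration $C$ of g-2PATH there is a time $t_C$ such that no node is in $\mathcal F$ at any time $t<t_C$ and every node is in $\mathcal F$ at time $t_C$; then $\mathrm{ft}(C,A)=t_C$. Solutions exist, and $\mathrm{mft}_{\text{g-2PATH}}(C)=\min_A\mathrm{ft}(C,A)$ over all solutions $A$. For a fixed configuration $C=p_r\dots p_s$ and $r\le i\le0\le j\le s$: $W(i,j)$ is the set of pairs $(x_0,x_1)$ of finite, possibly empty, sequences of positions such that $x_0p_i\dots p_jx_1$ is a configuration $C'$ of g-2PATH (with general at $p_0$) satisfying $\mathrm{bc}_{C'}(p_l)=\mathrm{bc}_C(p_l)$ for all $i\le l\le j$. $U(i,j)=\{x_0:\exists x_1,(x_0,x_1)\in W(i,j)\}$, $V(i,j)=\{x_1:\exists x_0,(x_0,x_1)\in W(i,j)\}$, $f(i,j)=\sup\{|x_0|:x_0\in U(i,j)\}$, $g(i,j)=\sup\{|x_1|:x_1\in V(i,j)\}$, where $|x|$ is the number of positions in $x$; these may be $\infty$, with the convention $\max\{a,\infty\}=\infty$. *)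

(* Defs.v *)
From Stdlib Require Import ClassicalEpsilon.
From HB Require Import structures.
From mathcomp Require Import all_boot all_order all_algebra.
Set Implicit Arguments. Unset Strict Implicit. Unset Printing Implicit Defensive.
Import GRing.Theory.

Definition pos := (int * int)%type.
Definition origin : pos := ((Posz 0), (Posz 0)).
Definition padd (p q : pos) : pos := ((p.1 + q.1)%R, (p.2 + q.2)%R).
Definition eps0 : pos := ((Posz 1), (Posz 0)).
Definition eps1 : pos := ((Posz 0), (Posz 1)).
Definition eps2 : pos := ((-1)%R, (Posz 0)).
Definition eps3 : pos := ((Posz 0), (-1)%R).
Definition adjacent (p p' : pos) : bool :=
  [|| p' == padd p eps0, p' == padd p eps1, p' == padd p eps2 | p' == padd p eps3].

(* ---------- configurations of g-2PATH ----------
   A configuration p_r ... p_s is represented by a list [l] together with the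
   index [k] of the general: p_i = nth origin l (k + i), so r = -k and
   s = size l - 1 - k. *)
Definition is_config (k : nat) (l : seq pos) : Prop :=
  [/\ k < size l,
      nth origin l k = origin,
      (forall n, n.+1 < size l -> adjacent (nth origin l n) (nth origin l n.+1)),
      uniq l &
      (forall a b, a < size l -> b < size l -> a.+2 <= b ->
         ~~ adjacent (nth origin l a) (nth origin l b))].

Definition bcond := (bool * bool * bool * bool)%type.
Definition bc (l : seq pos) (p : pos) : bcond :=
  (padd p eps0 \in l, padd p eps1 \in l, padd p eps2 \in l, padd p eps3 \in l).

Record automaton := Automaton {
  St : finType;
  Qs : St;
  m_gen : nat;
  Gs : 'I_m_gen -> St;
  Fs : pred St;
  tau : bcond -> 'I_m_gen;
  delta : St -> option St -> option St -> option St -> option St -> St;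
     (* current state, then states at p+eps0, p+eps1, p+eps2, p+eps3;
        None stands for the boundary symbol # *)
  Gs_inj : injective Gs;
  Gs_neqQ : forall i, Gs i != Qs;
  Q_notF : ~~ Fs Qs;
  Q_stable : forall a b c d : option St,
      a \in [:: Some Qs; None] -> b \in [:: Some Qs; None] ->
      c \in [:: Some Qs; None] -> d \in [:: Some Qs; None] ->
      delta Qs a b c d = Qs
}.

(* global state of the array at time t (only positions in l matter) *)
Fixpoint state (A : automaton) (l : seq pos) (t : nat) : pos -> St A :=
  match t with
  | 0 => fun p => if p == origin then Gs (tau A (bc l origin)) else Qs A
  | t'.+1 => fun p =>
      let nb (e : pos) := if padd p e \in l
                          then Some (state A l t' (padd p e)) else None in
      delta (state A l t' p) (nb eps0) (nb eps1) (nb eps2) (nb eps3)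
  end.

Definition fires_at (A : automaton) (l : seq pos) (t : nat) : Prop :=
  (forall t', t' < t -> forall p, p \in l -> ~~ Fs (state A l t' p)) /\
  (forall p, p \in l -> Fs (state A l t p)).

Definition is_solution (A : automaton) : Prop :=
  forall k l, is_config k l -> exists t, fires_at A l t.

Definition is_mft (l : seq pos) (n : nat) : Prop :=
  (exists A, is_solution A /\ fires_at A l n) /\
  (forall A t, is_solution A -> fires_at A l t -> n <= t).

Definition mft (l : seq pos) : nat := epsilon (inhabits 0) (is_mft l).

Inductive enat := Fin of nat | Inf.
Definition eadd (x y : enat) : enat :=
  match x, y with Fin a, Fin b => Fin (a + b) | _, _ => Inf end.
Definition emax (x y : enat) : enat :=
  match x, y with Fin a, Fin b => Fin (maxn a b) | _, _ => Inf end.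
Definition emin (x y : enat) : enat :=
  match x, y with
  | Fin a, Fin b => Fin (minn a b) | Inf, y => y | x, Inf => x end.
Definition ele (x y : enat) : Prop :=
  match x, y with Fin a, Fin b => a <= b | _, Inf => True | Inf, Fin _ => False end.

Definition esup (P : nat -> Prop) : enat :=
  match excluded_middle_informative (exists n, forall k, P k -> k <= n) with
  | left _ => Fin (epsilon (inhabits 0)
                (fun n => (forall k, P k -> k <= n) /\
                          (forall m, (forall k, P k -> k <= m) -> n <= m)))
  | right _ => Inf
  end.

(* ---------- W(i,j), f(i,j), g(i,j) ----------
   Indices: i = -a, j = b with a <= k, b <= s.  The segment p_i ... p_j. *)
Definition segment (k : nat) (l : seq pos) (a b : nat) : seq pos :=
  drop (k - a) (take (k + b).+1 l).

Definition W (k : nat) (l : seq pos) (a b : nat) (x0 x1 : seq pos) : Prop :=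
  let C' := x0 ++ segment k l a b ++ x1 in
  is_config (size x0 + a) C' /\
  (forall q, q \in segment k l a b -> bc C' q = bc l q).

Definition f_fun (k : nat) (l : seq pos) (a b : nat) : enat :=
  esup (fun n => exists x0 x1, W k l a b x0 x1 /\ size x0 = n).
Definition g_fun (k : nat) (l : seq pos) (a b : nat) : enat :=
  esup (fun n => exists x0 x1, W k l a b x0 x1 /\ size x1 = n).

Definition Ttilde (k : nat) (l : seq pos) : enat :=
  foldr emin Inf
    [seq emax (eadd (Fin (2 * ab.1 + ab.2)) (g_fun k l ab.1 ab.2))
              (eadd (Fin (2 * ab.2 + ab.1)) (f_fun k l ab.1 ab.2))
    | ab <- [seq (a, b) | a <- iota 0 k.+1, b <- iota 0 (size l - k)]].

(* Main.v *)
(** The minimum in the bound is taken over finitely many pairs (i,j), so it is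
    enough to find, for each pair with finite f and g, a solution firing at C by
    time T = max (-2i+j+g) (2j-i+f).  Start from an arbitrary solution and let every
    node also gather which nodes p_i, ..., p_j exist with the same boundary
    conditions as in C.  Information flooding from the general tells every node
    within time T whether all of them do: if so, the configuration extends
    p_i ... p_j by at most f and g nodes, and p_i is the last to be heard of on the
    right, p_j on the left.  All nodes therefore agree at time T, and firing then
    unless the given solution has already fired is again a solution.

    That a solution exists at all is shown with Minsky's divide-and-conquer
    algorithm: in a segment between two walls a signal of speed 1, reflected at the
    far end, meets a signal of speed 1/3 in the middle, which becomes a wall; all
    segments have the same length at all times, so the last gaps close
    simultaneously.  It is run along the path from one of its ends, after a wave from
    the general has given every node a consistent notion of left and right. *)

From Stdlib Require Import ClassicalEpsilon FunctionalExtensionality.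
From HB Require Import structures.
Require Import Defs.
From mathcomp Require Import all_boot all_order all_algebra.
From mathcomp Require Import zify.
Set Implicit Arguments. Unset Strict Implicit. Unset Printing Implicit Defensive.

(** * Minsky's algorithm on a line *)

(* The boolean is the direction of travel, [true] meaning rightwards; [Slow0],
   [Slow1], [Slow2] are the three phases of the signal of speed 1/3, and [Start] is
   [Fast] and [Slow0] on the same cell.  A [NewWall] triggers its quiet neighbours. *)
Inductive cell :=
  | Quiet | Wall | NewWall
  | Start of bool | Fast of bool | Slow0 of bool | Slow1 of bool | Slow2 of bool.

Definition cell_code (c : cell) : bool * (bool * bool * bool) :=
  match c with
  | Quiet => (false, (false, false, false))
  | Wall => (true, (false, false, false))
  | NewWall => (false, (false, false, true))
  | Start d => (d, (false, true, false))
  | Fast d => (d, (false, true, true))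
  | Slow0 d => (d, (true, false, false))
  | Slow1 d => (d, (true, false, true))
  | Slow2 d => (d, (true, true, false))
  end.
Definition cell_decode (x : bool * (bool * bool * bool)) : cell :=
  match x with
  | (false, (false, false, false)) => Quiet
  | (true, (false, false, false)) => Wall
  | (_, (false, false, true)) => NewWall
  | (d, (false, true, false)) => Start d
  | (d, (false, true, true)) => Fast d
  | (d, (true, false, false)) => Slow0 d
  | (d, (true, false, true)) => Slow1 d
  | (d, (true, true, _)) => Slow2 d
  end.
Lemma cell_codeK : cancel cell_code cell_decode.
Proof. by do ?case. Qed.
HB.instance Definition _ := Countable.copy cell (can_type cell_codeK).
HB.instance Definition _ : isFinite cell := CanIsFinite cell_codeK.

Definition is_wall (c : cell) : bool :=
  match c with Wall | NewWall => true | _ => false end.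

(* What a quiet cell becomes when [c] is the neighbour that a signal travelling in
   direction [d] would come from. *)
Definition entering (d : bool) (c : cell) : option cell :=
  match c with
  | NewWall => Some (Start d)
  | Start d' | Fast d' => if d' == d then Some (Fast d) else None
  | Slow2 d' => if d' == d then Some (Slow0 d) else None
  | _ => None
  end.

(* The signals meet either on one cell ([Slow0] facing [Fast]), or on two adjacent
   cells ([Slow2] facing [Fast]), according to the parity of the length. *)
Definition step (l c r : cell) : cell :=
  let front (d : bool) := if d then r else l in
  match c with
  | Quiet =>
      match entering true l, entering false r with
      | Some s, None | None, Some s => s
      | _, _ => Quiet
      end
  | Wall | NewWall => Wall
  | Start d => if is_wall (front d) then NewWall else Slow1 d
  | Fast d =>
      if is_wall (front d) then Fast (~~ d)
      else if front d == Slow2 (~~ d) then NewWall else Quiet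
  | Slow0 d => if front d == Fast (~~ d) then NewWall else Slow1 d
  | Slow1 d => Slow2 d
  | Slow2 d => if front d == Fast (~~ d) then NewWall else Quiet
  end.

Definition flip (c : cell) : cell :=
  match c with
  | Start d => Start (~~ d) | Fast d => Fast (~~ d)
  | Slow0 d => Slow0 (~~ d) | Slow1 d => Slow1 (~~ d) | Slow2 d => Slow2 (~~ d)
  | c => c
  end.

(** Reflecting the line exchanges the two directions, so it suffices to analyse segments triggered
    from the left. *)
Lemma step_flip l c r : step (flip r) (flip c) (flip l) = flip (step l c r).
Proof.
by case: c => [|||[]|[]|[]|[]|[]]; case: l => [|||[]|[]|[]|[]|[]];
   case: r => [|||[]|[]|[]|[]|[]].
Qed.

Lemma is_wall_flip c : is_wall (flip c) = is_wall c.
Proof. by case: c. Qed.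

Definition evolves (L : nat) (c : nat -> nat -> cell) : Prop :=
  forall t x, 0 < x <= L -> c t.+1 x = step (c t x.-1) (c t x) (c t x.+1).

Definition left_started (L : nat) (c : nat -> nat -> cell) : Prop :=
  [/\ forall t, c t 0 = if t == 0 then NewWall else Wall,
      forall t, c t L.+1 = Wall &
      forall x, 0 < x <= L -> c 0 x = Quiet].

(** The space-time diagram of one phase in closed form: the fast signal is at [t], and after its
    reflection at [L.*2.+1 - t]; the slow one occupies cell [x] from time [3 * x - 2] to [3 * x]. *)
Definition traj (L t x : nat) : cell :=
  if t == 0 then Quiet
  else if x == t then (if t == 1 then Start true else Fast true)
  else if (L < t) && (x + t == L.*2.+1) then Fast false
  else if t.+2 == 3 * x then Slow0 true
  else if t.+1 == 3 * x then Slow1 true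
  else if t == 3 * x then Slow2 true
  else Quiet.

(** Splits on innermost conditions first, so that every condition is plain arithmetic and [lia]
    discards the impossible branches. *)
Ltac dec_if :=
  repeat match goal with
  | |- context [if ?b then _ else _] =>
      lazymatch b with context [if _ then _ else _] => fail | _ => idtac end;
      let H := fresh in case H : b; [try lia|try lia]
  end.

Lemma traj_step L c t x : evolves L c -> left_started L c ->
  t < L + L./2 -> (forall y, 0 < y <= L -> c t y = traj L t y) ->
  0 < x <= L -> c t.+1 x = traj L t.+1 x.
Proof.
move=> ev [c0 cL cq] ht IH hx; rewrite ev // (IH x) //.
have -> : c t x.-1 = if x == 1 then (if t == 0 then NewWall else Wall)
                     else traj L t x.-1.
  by case: eqP => [->|h] //; rewrite IH //; lia.
have -> : c t x.+1 = if x == L then Wall else traj L t x.+1.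
  by case: eqP => [->|h] //; rewrite IH //; lia.
rewrite /traj; dec_if; rewrite //=.
Qed.

Lemma traj_run L c : evolves L c -> left_started L c ->
  forall t x, t <= L + L./2 -> 0 < x <= L -> c t x = traj L t x.
Proof.
move=> ev st; elim=> [|t IH] x ht hx; first by case: st => _ _ ->.
by apply: (traj_step ev st) => // y hy; apply: IH => //; lia.
Qed.

(** At time [L + L./2] the signals are about to meet. The two cells named here coincide for odd [L]
    and are adjacent for even [L]. *)
Lemma phase_end L c x : evolves L c -> left_started L c -> 0 < x <= L ->
  c (L + L./2).+1 x =
    if (x == uphalf L) || (x == L./2.+1) then NewWall else Quiet.
Proof.
move=> ev st hx; have [c0 cL cq] := st.
rewrite ev // (@traj_run _ _ ev st _ x) //.
set t := L + L./2.
have -> : c t x.-1 = if x == 1 then (if t == 0 then NewWall else Wall)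
                     else traj L t x.-1.
  by case: eqP => [->|h] //; rewrite (traj_run ev st) //; lia.
have -> : c t x.+1 = if x == L then Wall else traj L t x.+1.
  by case: eqP => [->|h] //; rewrite (traj_run ev st) //; lia.
by rewrite /t /traj; dec_if; rewrite //=.
Qed.

(** The first clause looks one cell around [x] because that is all a cell can see: it makes the
    local test [walled] fail everywhere before [T]. *)
Definition synchronizes (L T : nat) (c : nat -> nat -> cell) : Prop :=
  (forall t x, t < T -> x <= L.+1 ->
     exists y, [/\ y <= L.+1, x <= y.+1, y <= x.+1 & ~~ is_wall (c t y)]) /\
  (forall x, x <= L.+1 -> is_wall (c T x)).

Definition mirror (L : nat) (c : nat -> nat -> cell) t x := flip (c t (L.+1 - x)).

Lemma evolves_mirror L c : evolves L c -> evolves L (mirror L c).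
Proof.
move=> ev t x hx; rewrite /mirror ev; last by lia.
have -> : (L.+1 - x).-1 = L.+1 - x.+1 by lia.
have -> : (L.+1 - x).+1 = L.+1 - x.-1 by lia.
by rewrite step_flip.
Qed.

Lemma synchronizes_mirror L T c :
  synchronizes L T (mirror L c) -> synchronizes L T c.
Proof.
move=> [before at_end]; split=> [t x ht hx|x hx].
  have [y [h1 h2 h3]] := before t (L.+1 - x) ht ltac:(lia).
  rewrite /mirror is_wall_flip => h4; exists (L.+1 - y).
  by split=> //; lia.
have := at_end (L.+1 - x) ltac:(lia).
by rewrite /mirror is_wall_flip subKn.
Qed.

(** [T] is chosen before [c], so segments of equal length finish together. A phase leaves two halves
    of length [(uphalf L).-1]; the left one is triggered from its right end, hence the mirrored
    alternative. *)
Lemma segment_synchronizes L :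
  exists T, forall c, evolves L c ->
    left_started L c \/ left_started L (mirror L c) -> synchronizes L T c.
Proof.
elim/ltn_ind: L => L IH.
suff [T HT] : exists T, forall c, evolves L c -> left_started L c ->
    synchronizes L T c.
  exists T => c ev [st|st]; first exact: HT.
  by apply: synchronizes_mirror; apply: HT => //; exact: evolves_mirror.
have [->|L_gt0] := posnP L.
  exists 0 => c ev [c0 cL cq]; split=> // -[|[|x]] // _.
    by rewrite c0.
  by rewrite cL.
have [T' HT'] := IH (uphalf L).-1 ltac:(lia).
exists ((L + L./2).+1 + T') => c ev st.
have pe := phase_end ev st; have tr := traj_run ev st.
have [c0 cL cq] := st.
set t1 := (L + L./2).+1; set m1 := uphalf L; set m2 := L./2.+1.
have wallS t x : 0 < x <= L -> is_wall (c t x) -> c t.+1 x = Wall.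
  by move=> hx; rewrite ev //; case: (c t x).
have m1N : c t1 m1 = NewWall by rewrite pe ?eqxx //; lia.
have m2N : c t1 m2 = NewWall by rewrite pe ?eqxx ?orbT //; lia.
have midW m t : 0 < m <= L -> c t1 m = NewWall -> c (t1 + t.+1) m = Wall.
  move=> hm mN; elim: t => [|t IHt].
    by rewrite addn1 wallS // mN.
  by rewrite addnS wallS // IHt.
have [] : synchronizes m1.-1 T' (fun t x => c (t1 + t) x).
  apply: HT' => [t x hx|]; first by rewrite addnS ev //; lia.
  right; split=> [t|t|x hx]; rewrite /mirror.
  - rewrite subn0 prednK; last by lia.
    by case: t => [|t] /=; rewrite ?addn0 ?m1N // midW //; lia.
  - by rewrite subnn c0.
  - by rewrite addn0 pe; [case: ifP => //; lia | lia].
rewrite prednK; last by lia.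
move=> lbefore lend.
have [] : synchronizes m1.-1 T' (fun t x => c (t1 + t) (m2 + x)).
  apply: HT' => [t x hx|].
    rewrite !addnS ev; last by lia.
    by congr step; congr c; lia.
  left; split=> [t|t|x hx].
  - by rewrite addn0; case: t => [|t] /=; rewrite ?addn0 ?m2N // midW //; lia.
  - by have -> : m2 + m1.-1.+1 = L.+1 by lia.
  - by rewrite addn0 pe; [case: ifP => //; lia | lia].
rewrite prednK; last by lia.
move=> rbefore rend; split=> [t x ht hx|x hx]; last first.
  have [h|h] := leqP x m1; first exact: lend.
  have -> : x = m2 + (x - m2) by lia.
  by apply: rend; lia.
have [tlt|tge] := ltnP t t1.
  (* During the first phase no inner cell is a wall; the two end walls use their inner neighbours as
     witnesses. *)
  exists (if x == 0 then 1 else if x == L.+1 then L else x).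
  split; try (do !case: eqP => ?; lia).
  rewrite tr; [|lia|do !case: eqP => ?; lia].
  by rewrite /traj; do !case: ifP => //.
have -> : t = t1 + (t - t1) by lia.
have [h|h] := leqP x m1.
  have [y [h1 h2 h3 h4]] := lbefore (t - t1) x ltac:(lia) h.
  by exists y; split=> //; lia.
have [y [h1 h2 h3 h4]] := rbefore (t - t1) (x - m2) ltac:(lia) ltac:(lia).
by exists (m2 + y); split=> //; lia.
Qed.

(* Cells 1, ..., N; the boundary symbol # acts as a wall, at positions 0 and N+1. *)
Definition line_step (N : nat) (w : nat -> cell) (x : nat) : cell :=
  if 0 < x <= N then step (w x.-1) (w x) (w x.+1) else Wall.
Definition line_init (N x : nat) : cell :=
  if x == 1 then NewWall else if 0 < x <= N then Quiet else Wall.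
Fixpoint line (N t : nat) : nat -> cell :=
  if t is t'.+1 then line_step N (line N t') else line_init N.

Definition walled (l c r : cell) : bool := [&& is_wall l, is_wall c & is_wall r].

Lemma line_out N t x : 0 < N -> ~~ (0 < x <= N) -> line N t x = Wall.
Proof.
move=> N0 hx; case: t => [|t] /=.
  by rewrite /line_init (negPf hx); case: eqP => // ?; lia.
by rewrite /line_step (negPf hx).
Qed.

(** Nothing travels faster than one cell per step. This later keeps the signals behind the waking
    wave. *)
Lemma line_cone N t x : t.+1 < x <= N -> line N t x = Quiet.
Proof.
elim: t x => [|t IH] x hx /=.
  by rewrite /line_init ifF ?ifT //; lia.
rewrite /line_step ifT; last by lia.
rewrite (IH x.-1) ?(IH x); try lia.
have [h|h] := leqP x.+1 N; first by rewrite IH //; lia.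
by rewrite line_out //; lia.
Qed.

Lemma line_synchronizes N : 0 < N -> exists T,
  (forall t x, t < T -> 0 < x <= N ->
     ~~ walled (line N t x.-1) (line N t x) (line N t x.+1)) /\
  (forall x, 0 < x <= N ->
     walled (line N T x.-1) (line N T x) (line N T x.+1)).
Proof.
(* Cell 1 is a wall from the start and acts as the left wall, so only [N.-1] cells lie between the
   walls. *)
move=> N0; have [T HT] := segment_synchronizes N.-1.
have first_wall t : line N t 1 = if t == 0 then NewWall else Wall.
  elim: t => [|t IH] //=.
  by rewrite /line_step ifT ?IH; [case: eqP | lia].
have [] : synchronizes N.-1 T (fun t x => line N t x.+1).
  apply: HT => [t x hx|].
    by rewrite /= {1}/line_step ifT ?prednK //; lia.
  left; split=> [t|t|x hx].
  - exact: first_wall.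
  - by rewrite prednK // line_out //; lia.
  - by rewrite /= /line_init ifF ?ifT //; lia.
rewrite prednK // => before at_end; exists T; split=> [t x ht hx|x hx].
  have [[|y] [h1 h2 h3 h4]] := before t x.-1 ht ltac:(lia).
    by move: h4; rewrite first_wall; case: (t == 0).
  move: h4; apply: contra => /and3P[w1 w2 w3].
  have [->|[->|->]] // : y.+2 = x.-1 \/ y.+2 = x \/ y.+2 = x.+1 by lia.
have wl y : y <= N.+1 -> is_wall (line N T y).
  by case: y => [|y] hy; [rewrite line_out | exact: at_end].
by apply/and3P; split; apply: wl; lia.
Qed.

(** * Configurations and automata *)

Definition dir := (bool * bool)%type.
Definition eps (d : dir) : pos :=
  match d with
  | (false, false) => eps0 | (true, false) => eps1
  | (false, true) => eps2 | (true, true) => eps3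
  end.
Definition back (d : dir) : dir := (d.1, ~~ d.2).
Definition mv (p : pos) (d : dir) : pos := padd p (eps d).

Lemma mv_inj p : injective (mv p).
Proof. by move: p => [x y] [[] []] [[] []] //= []; lia. Qed.

Lemma mv_injl d : injective (mv^~ d).
Proof.
by move: d => [[] []] [x y] [x' y'] /= [] h1 h2; congr pair; lia.
Qed.

Lemma mv_opp p d : mv (mv p d) (back d) = p.
Proof. by move: p d => [x y] [[] []]; rewrite /mv /padd /=; congr pair; lia. Qed.

Lemma adjacentP p p' : reflect (exists d, p' = mv p d) (adjacent p p').
Proof.
apply: (iffP idP) => [|[[[] []] ->]]; rewrite /adjacent /mv ?eqxx ?orbT //.
by case/or4P => /eqP ->;
  [exists (false, false) | exists (true, false)
  | exists (false, true) | exists (true, true)].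
Qed.

Lemma adjacent_sym p p' : adjacent p p' = adjacent p' p.
Proof.
suff h q q' : adjacent q q' -> adjacent q' q by apply/idP/idP; exact: h.
by case/adjacentP => d ->; apply/adjacentP; exists (back d); rewrite mv_opp.
Qed.

Lemma adjacentxx p : adjacent p p = false.
Proof.
apply/negP => /adjacentP [[[] []]]; move: p => [x y]; rewrite /mv /padd /= => -[];
  lia.
Qed.

Notation cell_at l n := (nth origin l n).

(** Since distant cells of the path never touch, a node sees exactly its predecessor and its
    successor. *)
Lemma config_adjacent k l : is_config k l -> forall a b,
  a < size l -> b < size l ->
  adjacent (cell_at l a) (cell_at l b) = (a.+1 == b) || (b.+1 == a).
Proof.
move=> [kl l0 cons u far] a b ha hb.
have [ab|ab] := eqVneq a.+1 b; first by rewrite -ab cons // ab.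
have [ba|ba] := eqVneq b.+1 a; first by rewrite -ba adjacent_sym cons // ba.
apply/negP; have [h|h|->] := ltngtP a b; last by rewrite adjacentxx.
  by apply/negP; apply: far => //; lia.
by rewrite adjacent_sym; apply/negP; apply: far => //; lia.
Qed.

(** States depend only on the set of positions, so a path may be read in whichever direction is
    convenient. *)
Lemma config_rev k l : is_config k l -> is_config (size l - k.+1) (rev l).
Proof.
move=> [kl l0 cons u far]; split; rewrite ?size_rev ?rev_uniq //; first by lia.
- by rewrite nth_rev; [have -> : size l - (size l - k.+1).+1 = k by lia | lia].
- move=> n hn; rewrite !nth_rev; try lia.
  rewrite adjacent_sym; have -> : size l - n.+1 = (size l - n.+2).+1 by lia.
  by apply: cons; lia.
- move=> a b ha hb hab; rewrite !nth_rev // adjacent_sym; apply: far; lia.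
Qed.

Lemma eq_bc l l' p : l =i l' -> bc l p = bc l' p.
Proof. by move=> h; rewrite /bc !h. Qed.

Lemma eq_state A l l' : l =i l' -> forall t, state A l t =1 state A l' t.
Proof.
move=> h; elim=> [|t IH] p /=; first by rewrite (eq_bc _ h).
by rewrite !h !IH.
Qed.

Lemma eq_fires_at A l l' t : l =i l' -> fires_at A l t -> fires_at A l' t.
Proof.
move=> h [h1 h2]; split=> [t' ht' p|p]; rewrite -h -(eq_state A h).
  exact: h1.
exact: h2.
Qed.

Definition has_bit (b : bcond) (d : dir) : bool :=
  let: (b0, b1, b2, b3) := b in
  match d with
  | (false, false) => b0 | (true, false) => b1
  | (false, true) => b2 | (true, true) => b3
  end.

Lemma has_bit_bc l p d : has_bit (bc l p) d = (mv p d \in l).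
Proof. by case: d => [[] []]. Qed.

Definition nbrs (T : Type) (l : seq pos) (st : pos -> T) (p : pos) (d : dir) :
    option T :=
  if mv p d \in l then Some (st (mv p d)) else None.

(* A firing-squad automaton before the bookkeeping required by [automaton] (a
   separate general state for every boundary condition) is added. *)
Section Run.
Variables (S : Type) (q : S) (G : bcond -> S) (D : S -> (dir -> option S) -> S).

Fixpoint run (l : seq pos) (t : nat) (p : pos) : S :=
  match t with
  | 0 => if p == origin then G (bc l origin) else q
  | t'.+1 => D (run l t' p) (nbrs l (run l t') p)
  end.

Lemma eq_run l l' : l =i l' -> forall t, run l t =1 run l' t.
Proof.
move=> h; elim=> [|t IH] p /=; first by rewrite (eq_bc _ h).
rewrite IH; congr D; apply: functional_extensionality => d.
by rewrite /nbrs h IH.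
Qed.
End Run.

Definition fires_run (F : nat -> pos -> bool) (l : seq pos) (t : nat) : Prop :=
  (forall t', t' < t -> forall p, p \in l -> ~~ F t' p) /\
  (forall p, p \in l -> F t p).

Definition inputs (T : Type) (a b c d : option T) (e : dir) : option T :=
  match e with
  | (false, false) => a | (true, false) => b
  | (false, true) => c | (true, true) => d
  end.

Section Automaton_of.
Variables (S : finType) (q : S) (G : bcond -> S).
Variables (D : S -> (dir -> option S) -> S) (F : pred S).
Hypothesis q_notF : ~~ F q.
Hypothesis q_stable : forall i : dir -> option S,
  (forall d, i d \in [:: Some q; None]) -> D q i = q.

Let S' := (S * option bcond)%type.
Let fst_inputs (a b c d : option S') (e : dir) : option S :=
  omap fst (inputs a b c d e).

(** The tag [Some b] separates the general states from each other and from the quiescent state,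
    whose tag is [None]; the first step erases it. *)
Definition automaton_of : automaton.
Proof.
refine (@Automaton S' (q, None) #|{: bcond}|
  (fun i => (G (enum_val i), Some (enum_val i)))
  (fun s => F s.1)
  (fun b => enum_rank b)
  (fun s a b c d => (D s.1 (fst_inputs a b c d), None)) _ _ _ _).
- by move=> i j [_ /enum_val_inj].
- by move=> i; apply/eqP => -[].
- exact: q_notF.
- move=> a b c d ha hb hc hd /=; congr pair; apply: q_stable => e.
  have {ha hb hc hd} : inputs a b c d e \in [:: Some (q, None); None].
    by case: e => [[] []].
  by rewrite /fst_inputs !inE => /orP[] /eqP -> /=; rewrite eqxx ?orbT.
Defined.

Lemma state_automaton_of l t p : (state automaton_of l t p).1 = run q G D l t p.
Proof.
elim: t p => [|t IH] p /=.
  by case: eqP => // _; rewrite enum_rankK.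
rewrite IH; congr D; apply: functional_extensionality => d.
rewrite /nbrs -IH /fst_inputs /mv.
by case: d => [[] []] /=; case: ifP.
Qed.

Lemma fires_automaton_of l t :
  fires_run (fun t p => F (run q G D l t p)) l t -> fires_at automaton_of l t.
Proof.
by move=> [h1 h2]; split=> [t' ht' p hp|p hp] /=;
  rewrite state_automaton_of; [apply: h1 | apply: h2].
Qed.
End Automaton_of.

(** * A solution on paths *)

(** The default is never reached for consecutive cells of a configuration. *)
Definition toward (l : seq pos) (n m : nat) : dir :=
  odflt (false, false) [pick d | mv (cell_at l n) d == cell_at l m].
Definition left_link (l : seq pos) (n : nat) : option dir :=
  if 0 < n then Some (toward l n n.-1) else None.
Definition right_link (l : seq pos) (n : nat) : option dir :=
  if n.+1 < size l then Some (toward l n n.+1) else None.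

Lemma pick_unique (T : finType) (P : pred T) (o : option T) :
  (forall x, P x = (o == Some x)) -> [pick x | P x] = o.
Proof.
move=> h; case: pickP => [x|none].
  by rewrite h => /eqP ->.
by case: o h => // x h; have := none x; rewrite h eqxx.
Qed.

Section Links.
Variables (k : nat) (l : seq pos).
Hypothesis cfg : is_config k l.

Lemma towardE n m d : n < size l -> m < size l -> (m == n.+1) || (n == m.+1) ->
  (toward l n m == d) = (mv (cell_at l n) d == cell_at l m).
Proof.
move=> hn hm hnm; rewrite /toward.
have : adjacent (cell_at l n) (cell_at l m).
  by rewrite (config_adjacent cfg) //; lia.
case: pickP => [d' /eqP h _|none /adjacentP [d' h]].
  by rewrite -h /= (inj_eq (@mv_inj _)) eq_sym.
by have := none d'; rewrite h eqxx.
Qed.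

Lemma left_linkE n d : n < size l ->
  (left_link l n == Some d) = (0 < n) && (mv (cell_at l n) d == cell_at l n.-1).
Proof.
rewrite /left_link; case: n => [|n] hn //=; rewrite -towardE ?eqxx ?orbT //.
exact: ltnW.
Qed.

Lemma right_linkE n d : n < size l ->
  (right_link l n == Some d) =
  (n.+1 < size l) && (mv (cell_at l n) d == cell_at l n.+1).
Proof.
move=> hn; rewrite /right_link; case: (ltnP n.+1) => //= h.
by rewrite -towardE ?eqxx.
Qed.

Lemma mem_mv n d : n < size l ->
  (mv (cell_at l n) d \in l) = (left_link l n == Some d) || (right_link l n == Some d).
Proof.
move=> hn; rewrite left_linkE // right_linkE //; apply/idP/idP.
  move=> /(nthP origin)[m hm e].
  have : adjacent (cell_at l n) (cell_at l m) by apply/adjacentP; exists d.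
  rewrite (config_adjacent cfg) // => /orP[] /eqP h; apply/orP.
    by right; rewrite h hm -e eqxx.
  left; have -> : n.-1 = m by lia.
  by rewrite -e eqxx andbT; lia.
case/orP => /andP[h /eqP ->]; apply: mem_nth => //.
exact: leq_ltn_trans (leq_pred n) hn.
Qed.

Lemma left_neq_right n d : n < size l ->
  left_link l n = Some d -> right_link l n = Some d -> False.
Proof.
move=> hn /eqP; rewrite left_linkE // => /andP[n0 /eqP h1] /eqP.
rewrite right_linkE // => /andP[h2 /eqP]; rewrite h1 => /eqP.
case: cfg => _ _ _ u _; rewrite nth_uniq //; first by lia.
exact: leq_ltn_trans (leq_pred n) hn.
Qed.

Lemma link_opp n d : n < size l ->
  left_link l n.+1 = Some d -> n.+1 < size l -> right_link l n = Some (back d).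
Proof.
move=> hn /eqP h hn1; move: h; rewrite left_linkE //= => /eqP h.
by apply/eqP; rewrite right_linkE // hn1 -h mv_opp eqxx.
Qed.

Lemma link_opp' n d : n < size l ->
  right_link l n = Some d -> left_link l n.+1 = Some (back d).
Proof.
move=> hn /eqP; rewrite right_linkE // => /andP[h1 /eqP h].
by apply/eqP; rewrite left_linkE //= -h mv_opp.
Qed.

Lemma pick_right n : n < size l ->
  [pick e | (mv (cell_at l n) e \in l) && (Some e != left_link l n)] =
  right_link l n.
Proof.
move=> hn; apply: pick_unique => e; rewrite mem_mv // eq_sym.
case: eqP => [h|_] /=; last by rewrite andbT.
by apply/esym/eqP; exact: left_neq_right (esym h).
Qed.

Lemma pick_left n : n < size l ->
  [pick e | (mv (cell_at l n) e \in l) && (Some e != right_link l n)] =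
  left_link l n.
Proof.
move=> hn; apply: pick_unique => e; rewrite mem_mv // orbC eq_sym.
case: eqP => [h|_] /=; last by rewrite andbT.
by apply/esym/eqP => h'; exact: left_neq_right h' (esym h).
Qed.

Lemma nbrs_at (T : Type) (st : pos -> T) n d : n < size l ->
  nbrs l st (cell_at l n) d =
    if left_link l n == Some d then Some (st (cell_at l n.-1))
    else if right_link l n == Some d then Some (st (cell_at l n.+1)) else None.
Proof.
move=> hn; rewrite /nbrs mem_mv //.
case: eqP => [/eqP|_] /=; first by rewrite left_linkE // => /andP[_ /eqP ->].
by case: eqP => [/eqP|_] //=; rewrite right_linkE // => /andP[_ /eqP ->].
Qed.

Lemma left_link_rev n : n < size l ->
  left_link (rev l) (size l - n.+1) = right_link l n.
Proof.
move=> hn; rewrite /left_link /right_link /toward.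
have -> : (0 < size l - n.+1) = (n.+1 < size l) by lia.
case: ltnP => // h; congr (Some (odflt _ _)).
have -> : (size l - n.+1).-1 = size l - n.+2 by lia.
rewrite !nth_rev; try lia.
have -> : size l - (size l - n.+1).+1 = n by lia.
by have -> : size l - (size l - n.+2).+1 = n.+1 by lia.
Qed.
End Links.

(** * The waking wave followed by Minsky's algorithm *)

Definition links := (option dir * option dir)%type.

Definition general_links (b : bcond) : links :=
  let L := [pick d | has_bit b d] in
  (L, [pick d | has_bit b d && (Some d != L)]).

(* The general takes the first neighbour it sees as its left one. *)
Lemma oriented_config k l : is_config k l -> exists k' l',
  [/\ is_config k' l', l =i l', 0 < k' \/ size l' = 1 &
      general_links (bc l' origin) = (left_link l' k', right_link l' k')].
Proof.
move=> cfg; have [kl l0 _ _ _] := cfg.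
have hL k' l' : is_config k' l' ->
    [pick d | has_bit (bc l' origin) d] = left_link l' k' ->
    general_links (bc l' origin) = (left_link l' k', right_link l' k').
  move=> cfg'; have [kl' l0' _ _ _] := cfg'.
  rewrite /general_links => ->; congr pair; rewrite -(pick_right cfg') //.
  by apply: eq_pick => d; rewrite has_bit_bc l0'.
have bitE d : has_bit (bc l origin) d =
    (left_link l k == Some d) || (right_link l k == Some d).
  by rewrite has_bit_bc -(mem_mv cfg) // l0.
case E: [pick d | has_bit (bc l origin) d] => [d|].
  have : has_bit (bc l origin) d by move: E; case: pickP => // x hx [<-].
  rewrite bitE => /orP[] /eqP h.
    exists k, l; split=> //; last by apply: hL; rewrite ?E.
    by left; move: h; rewrite /left_link; case: ltnP.
  (* The neighbour seen first is the right one; reversing the list makes it the left one. *)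
  have hlr := left_link_rev kl; rewrite h in hlr.
  have mem : l =i rev l by move=> p; rewrite mem_rev.
  exists (size l - k.+1), (rev l); split=> //; first exact: config_rev.
    left; move: h; rewrite /right_link; case: ltnP => // ? _; lia.
  by apply: hL; [exact: config_rev | rewrite -(eq_bc _ mem) E hlr].
have none : left_link l k = None /\ right_link l k = None.
  move: E; case: pickP => // none _.
  by split; [case e: (left_link l k) => [d|] | case e: (right_link l k) => [d|]];
    rewrite //; have := none d; rewrite bitE e eqxx ?orbT.
exists k, l; split=> //; last by apply: hL; rewrite ?E; case: none.
case: none; rewrite /left_link /right_link; case: ltnP => //; case: ltnP => //.
lia.
Qed.

(** The links are [None] until the wave arrives. The boolean is the firing flag, which records with
    a delay of one step that the node and both neighbours were walls. *)
Definition node := (option links * (cell * bool))%type.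
Definition asleep : node := (None, (Quiet, false)).
Definition end_cell (L : option dir) : cell :=
  if L is None then NewWall else Quiet.

Definition general_node (b : bcond) : node :=
  (Some (general_links b), (end_cell (general_links b).1, false)).

Definition points_at_me (i : dir -> option node) (side : links -> option dir)
    (d : dir) : bool :=
  if i d is Some (Some ln, _) then side ln == Some (back d) else false.
Definition other_dir (i : dir -> option node) (d : dir) : option dir :=
  [pick e | isSome (i e) && (Some e != Some d)].

(** A neighbour whose right link points here must lie on the left, and conversely; any remaining
    neighbour lies on the other side. *)
Definition wake (i : dir -> option node) : option links :=
  if [pick d | points_at_me i snd d] is Some d then Some (Some d, other_dir i d)
  else if [pick d | points_at_me i fst d] is Some d
  then Some (other_dir i d, Some d) else None.

Definition look (i : dir -> option node) (o : option dir) : cell :=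
  if o is Some d then (if i d is Some s then s.2.1 else Wall) else Wall.

Definition node_step (s : node) (i : dir -> option node) : node :=
  match s.1 with
  | Some (L, R) =>
      (Some (L, R), (step (look i L) s.2.1 (look i R),
                     walled (look i L) s.2.1 (look i R)))
  | None =>
      (wake i, (if wake i is Some (L, _) then end_cell L else Quiet, false))
  end.

Lemma node_step_asleep (i : dir -> option node) :
  (forall d, i d \in [:: Some asleep; None]) -> node_step asleep i = asleep.
Proof.
move=> hi; rewrite /node_step /=.
suff -> : wake i = None by [].
have none side d : points_at_me i side d = false.
  by rewrite /points_at_me; have := hi d; rewrite !inE => /orP[] /eqP ->.
rewrite /wake; case: pickP => [d|_]; first by rewrite none.
by case: pickP => [d|//]; rewrite none.
Qed.

Definition flag (N t x : nat) : bool :=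
  if t is t'.+1 then
    walled (line N t' x.-1) (line N t' x) (line N t' x.+1) else false.
(* The wave reaches the left end, where [line] is started, at time [k]. *)
Definition sim (k N t n : nat) : cell * bool :=
  if t < k then (Quiet, false) else (line N (t - k) n.+1, flag N (t - k) n.+1).

Section Sim.
Variables (k : nat) (l : seq pos).
Hypothesis cfg : is_config k l.
Hypothesis k_end : 0 < k \/ size l = 1.
Hypothesis glinks :
  general_links (bc l origin) = (left_link l k, right_link l k).

Let N := size l.
Let awake t n := (n <= k + t) && (k <= n + t).
Let node_at t n : node :=
  (if awake t n then Some (left_link l n, right_link l n) else None,
   sim k N t n).

(** The signals leave the left end only at time [k], so they cannot catch up with the wave that left
    the general rightwards at time 0. *)
Lemma sim_asleep t n : n < N -> ~~ awake t n -> sim k N t n = (Quiet, false).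
Proof.
rewrite /awake /sim => hn ha; case: ltnP => // kt.
rewrite line_cone; last by lia.
rewrite /flag; case E: (t - k) => [|t'] //.
by rewrite /walled (@line_cone N t' n.+1) ?andbF //; lia.
Qed.

Lemma end_cell_left n : end_cell (left_link l n) = if n == 0 then NewWall else Quiet.
Proof. by rewrite /left_link; case: n. Qed.

Lemma run_node t n : n < N -> run asleep general_node node_step l t (cell_at l n)
  = node_at t n.
Proof.
have [kl l0 _ u _] := cfg.
elim: t n => [|t IH] n hn.
  have /= -> : (cell_at l n == origin) = (n == k).
    by rewrite -[X in _ == X]l0 nth_uniq.
  case: eqP => [->|nk].
    rewrite /general_node glinks /node_at /awake /= !addn0 leqnn /=.
    rewrite end_cell_left /sim; case: k k_end => [|k'] //.
  have aw : ~~ awake 0 n by rewrite /awake; lia.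
  by rewrite /node_at sim_asleep // (negPf aw).
rewrite /= IH //; set i := nbrs _ _ _.
have iE d : i d = if left_link l n == Some d then Some (node_at t n.-1)
    else if right_link l n == Some d then Some (node_at t n.+1) else None.
  rewrite /i (nbrs_at cfg) //; case: eqP => _.
    by rewrite IH //; exact: leq_ltn_trans (leq_pred n) hn.
  case: eqP => // h; rewrite IH //.
  by move: h; rewrite /right_link; case: ltnP.
have lookL : look i (left_link l n) = if n == 0 then Wall else (sim k N t n.-1).1.
  case E: (left_link l n) => [d|]; last by move: E; rewrite /left_link; case: (n).
  by rewrite /= iE E eqxx; move: E; rewrite /left_link; case: (n).
have lookR : look i (right_link l n) =
    if n.+1 == N then Wall else (sim k N t n.+1).1.
  case E: (right_link l n) => [d|].
    rewrite /= iE ifF; last by apply/eqP => h; exact: (left_neq_right cfg hn h E).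
    rewrite E eqxx; move: E; rewrite /right_link ltn_neqAle.
    by case: (n.+1 == _).
  by move: E; rewrite /right_link ltn_neqAle hn andbT; case: (n.+1 == _).
rewrite /node_step /node_at /=.
have [aw|aw] := boolP (awake t n).
  have aw' : awake t.+1 n by move: aw; rewrite /awake; lia.
  rewrite lookL lookR aw'.
  congr pair; rewrite /sim; case: ltnP => tk.
    (* Before time [k] the left end is asleep, so Minsky's algorithm has not started and every cell
       is quiet. *)
    have n0 : n <> 0 by move: aw; rewrite /awake; lia.
    have -> : (step (if n == 0 then Wall else Quiet) Quiet
        (if n.+1 == N then Wall else Quiet),
        walled (if n == 0 then Wall else Quiet) Quiet
        (if n.+1 == N then Wall else Quiet)) = (Quiet, false).
      by case: ifP; case: ifP.
    case: ltnP => // ht; have -> : t.+1 - k = 0 by lia.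
    by rewrite /= /line_init eqSS hn; case: eqP.
  have -> : (t.+1 < k) = false by lia.
  rewrite subSn //= /line_step /= hn.
  have -> : (if n == 0 then Wall else line N (t - k) n.-1.+1) = line N (t - k) n.
    by case: (n) => //=; rewrite line_out //; lia.
  have -> : (if n.+1 == N then Wall else line N (t - k) n.+2) =
            line N (t - k) n.+2 by case: eqP => // ->; rewrite line_out //; lia.
  by [].
(* A sleeping node is called from its left exactly when the rightward front arrives, and, by [pL],
   from its right exactly when the leftward front does. *)
have pR d : points_at_me i snd d = (left_link l n == Some d) && (n == k + t.+1).
  rewrite /points_at_me iE; case: eqP => [h|_] /=.
    have n0 : 0 < n by move: h; rewrite /left_link; case: (n).
    have [m nm] : exists m, n = m.+1 by exists n.-1; lia.
    have hm : m < size l by rewrite nm in hn; exact: ltnW.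
    have hr : right_link l m = Some (back d).
      by apply: (link_opp cfg) => //; rewrite -nm.
    move: aw; rewrite /awake nm /=; case: ifP => [a1 a2|a1 a2]; last by lia.
    by rewrite hr eqxx; lia.
  case: eqP => [h|//].
  rewrite /node_at; case: ifP => // _ /=.
  have hn1 : n.+1 < size l by move: h; rewrite /right_link; case: ltnP.
  have := link_opp' cfg hn h => h'.
  by apply/eqP; exact: (left_neq_right cfg hn1 h').
have pL d : points_at_me i fst d = (right_link l n == Some d) && (n + t.+1 == k).
  rewrite /points_at_me iE; case: eqP => [h|_] /=.
    have n0 : 0 < n by move: h; rewrite /left_link; case: (n).
    have [m nm] : exists m, n = m.+1 by exists n.-1; lia.
    have hm : m < size l by rewrite nm in hn; exact: ltnW.
    have hr : right_link l m = Some (back d).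
      by apply: (link_opp cfg) => //; rewrite -nm.
    have -> : (right_link l n == Some d) = false.
      by apply/eqP; exact: (left_neq_right cfg hn h).
    rewrite nm /=; case: ifP => // _.
    by apply/eqP => h'; exact: (left_neq_right cfg hm h' hr).
  case: eqP => [h|//]; rewrite /node_at; move: aw; rewrite /awake.
  case: ifP => [a1 a2|a1 a2] /=; last by lia.
  by rewrite (link_opp' cfg hn h) eqxx; lia.
have otherE d : other_dir i d = [pick e | (mv (cell_at l n) e \in l) && (Some e != Some d)].
  apply: eq_pick => e /=; rewrite iE (mem_mv cfg) //.
  by case: eqP => //= _; case: eqP.
have otherL d : left_link l n = Some d -> other_dir i d = right_link l n.
  by move=> h; rewrite otherE -h (pick_right cfg).
have otherR d : right_link l n = Some d -> other_dir i d = left_link l n.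
  by move=> h; rewrite otherE -h (pick_left cfg).
have wakeE : wake i = if awake t.+1 n then Some (left_link l n, right_link l n) else None.
  rewrite /wake; case: pickP => [d|noR].
    rewrite pR => /andP[/eqP h1 h2].
    by rewrite ifT ?h1 ?(otherL _ h1) // /awake; lia.
  case: pickP => [d|noL].
    rewrite pL => /andP[/eqP h1 h2].
    by rewrite ifT ?h1 ?(otherR _ h1) // /awake; lia.
  rewrite ifF //; apply/negP => aw'.
  have [h|h] : n = k + t.+1 \/ n + t.+1 = k by move: aw aw'; rewrite /awake; lia.
    have n0 : 0 < n by lia.
    by have := noR (toward l n n.-1); rewrite pR /left_link n0 h !eqxx.
  have hn1 : n.+1 < size l by apply: leq_ltn_trans kl; lia.
  by have := noL (toward l n n.+1); rewrite pL /right_link hn1 h !eqxx.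
rewrite wakeE; congr pair.
case: ifP => aw'; last by rewrite sim_asleep // aw'.
rewrite end_cell_left /sim.
have [h|h] : n = k + t.+1 \/ n + t.+1 = k by move: aw aw'; rewrite /awake; lia.
  have k0 : 0 < k by case: k_end => // N1; move: hn; rewrite /N N1; lia.
  have -> : (n == 0) = false by lia.
  case: ltnP => ht //.
  rewrite line_cone; last by lia.
  have -> : flag N (t.+1 - k) n.+1 = false.
    rewrite /flag; case E: (t.+1 - k) => [|t'] //.
    by rewrite /walled (@line_cone N t' n.+1) ?andbF //; lia.
  by [].
case: ltnP => ht; first by rewrite (_ : (n == 0) = false) //; lia.
have -> : t.+1 - k = 0 by lia.
have -> : n = 0 by lia.
by [].
Qed.

Lemma sim_fires : exists t,
  fires_run (fun t p => (run asleep general_node node_step l t p).2.2) l t.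
Proof.
have [kl l0 _ u _] := cfg.
have N0 : 0 < N by exact: leq_ltn_trans kl.
have [T [before at_end]] := line_synchronizes N0.
exists (k + T.+1); split=> [t ht p|p] /(nthP origin)[n hn <-]; rewrite run_node //=.
  rewrite /sim; case: ltnP => // kt; rewrite /= /flag.
  by case E: (t - k) => [|t'] //; apply: before => //; lia.
rewrite /sim (_ : (k + T.+1 < k) = false) ?addKn; [exact: at_end | lia].
Qed.
End Sim.

Lemma solution_exists : exists A, is_solution A.
Proof.
exists (@automaton_of _ asleep general_node node_step (fun s => s.2.2) isT
  node_step_asleep) => k l cfg.
have [k' [l' [cfg' ll' kend glinks]]] := oriented_config cfg.
have [t ht] := sim_fires cfg' kend glinks.
exists t; apply: (@eq_fires_at _ l') => [p|]; first by rewrite ll'.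
exact: fires_automaton_of.
Qed.

(** * Recognizing a segment *)

Section Detector.
Variables (n T : nat) (seg : nat -> pos) (a : 'I_n) (want : pos -> bcond).

(** Besides the clock, a node stores its own index in the segment, if it has learnt one, and the set
    of indices it has heard to be present with the wanted boundary conditions. *)
Definition detector := ('I_T.+3 * option 'I_n * {set 'I_n})%type.
Definition clock (s : detector) : nat := s.1.1.
Definition own (s : detector) : option 'I_n := s.1.2.
Definition known (s : detector) : {set 'I_n} := s.2.

Definition idle : detector := (ord0, None, set0).
Definition det_general (b : bcond) : detector :=
  (inord 1, Some a, if b == want origin then [set a] else set0).

(** Indices spread from the general: the neighbour's index and the direction towards it determine
    the position of the node itself. *)
Definition located (i : dir -> option detector) (j : 'I_n) (d : dir) : bool :=
  if i d is Some s then
    if own s is Some j' then mv (seg j) d == seg j' else false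
  else false.
Definition bits (i : dir -> option detector) : bcond :=
  (isSome (i (false, false)), isSome (i (true, false)),
   isSome (i (false, true)), isSome (i (true, true))).
Definition clock_in (o : option detector) : nat :=
  if o is Some s then clock s else 0.
Definition known_in (o : option detector) : {set 'I_n} :=
  if o is Some s then known s else set0.

Definition max_clock (s : detector) (i : dir -> option detector) : nat :=
  maxn (clock s) (\max_d clock_in (i d)).
Definition new_own (s : detector) (i : dir -> option detector) : option 'I_n :=
  if own s is Some j then Some j
  else [pick j | [exists d, located i j d]].
Definition new_known (s : detector) (i : dir -> option detector) : {set 'I_n} :=
  known s :|: \bigcup_d known_in (i d)
  :|: [set j | (new_own s i == Some j) && (bits i == want (seg j))].

(* A clock reading of [0] marks a node not yet reached; otherwise the reading is
   one more than the time, saturating at [T.+2]. *)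
Definition det_step (s : detector) (i : dir -> option detector) : detector :=
  (inord (if max_clock s i == 0 then 0 else minn (max_clock s i).+1 T.+2),
   new_own s i, new_known s i).

(** The reading [T.+1] occurs at time [T] only, because the clock saturates one above it. *)
Definition det_fire (s : detector) : bool :=
  (clock s == T.+1) && (known s == setT).

Lemma det_step_idle (i : dir -> option detector) :
  (forall d, i d \in [:: Some idle; None]) -> det_step idle i = idle.
Proof.
move=> hi.
have clk d : clock_in (i d) = 0.
  by have := hi d; rewrite !inE => /orP[] /eqP ->.
have kn d : known_in (i d) = set0.
  by have := hi d; rewrite !inE => /orP[] /eqP ->.
have loc j d : located i j d = false.
  by rewrite /located; have := hi d; rewrite !inE => /orP[] /eqP ->.
have no_own : new_own idle i = None.
  rewrite /new_own /=; case: pickP => // j /existsP [d].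
  by rewrite loc.
rewrite /det_step no_own /max_clock /new_known no_own /idle.
rewrite (eq_bigr (fun=> 0)) // big1 // /clock /=.
congr (_, _, _); first by apply: val_inj; rewrite /= inordK.
apply/setP => j; rewrite !inE /= orbF; apply/negP => /bigcupP [d _].
by rewrite kn inE.
Qed.

Section Array.
Variable l' : seq pos.

Definition det (t : nat) (p : pos) : detector :=
  run idle det_general det_step l' t p.
Let ins t p := nbrs l' (det t) p.

Definition verified (j : 'I_n) : Prop :=
  seg j \in l' /\ bc l' (seg j) = want (seg j).

Hypothesis seg_a : seg a = origin.
Hypothesis l'0 : origin \in l'.

Lemma bits_ins t p : bits (ins t p) = bc l' p.
Proof. by rewrite /bits /ins /nbrs /bc /mv /=; congr (_, _, _, _); case: ifP. Qed.

Definition det_ok (t : nat) (p : pos) : Prop :=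
  det t p = idle \/
  [/\ clock (det t p) = minn t.+1 T.+2,
      (forall j, own (det t p) = Some j -> seg j = p) &
      forall j, j \in known (det t p) -> verified j].

(** Soundness on an arbitrary array: nodes not yet reached are idle, and whatever a reached node
    believes is true. *)
Lemma detP t p : p \in l' -> det_ok t p.
Proof.
elim: t p => [|t IH] p hp; rewrite /det_ok.
  rewrite /det /=; case: eqP => [->|_]; last by left.
  right; split=> [|j [<-] //|j]; first by rewrite /clock /= inordK.
  rewrite /known /=; case: eqP => [h|_]; rewrite inE // => /eqP ->.
  by split; rewrite seg_a.
have insE d : ins t p d = if mv p d \in l' then Some (det t (mv p d)) else None by [].
have -> : det t.+1 p = det_step (det t p) (ins t p) by [].
set c := max_clock (det t p) (ins t p).
have ok_p := IH p hp.
have ok_in d s : ins t p d = Some s -> exists2 p', s = det t p' & p' = mv p d /\ p' \in l'.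
  by rewrite insE; case: ifP => // h [<-]; exists (mv p d).
have clk_in d : clock_in (ins t p d) = 0 \/ clock_in (ins t p d) = minn t.+1 T.+2.
  case E: (ins t p d) => [s|]; last by left.
  have [p' -> [_ hp']] := ok_in d s E.
  by have [->|[h _ _]] := IH p' hp'; [left | right].
have idleP q : q \in l' -> clock (det t q) = 0 -> det t q = idle.
  by move=> hq; have [//|[-> _ _]] := IH q hq; rewrite minnSS.
have [c0|c0] := eqVneq c 0.
  left; rewrite /c /max_clock in c0.
  have [s0 i0] : clock (det t p) = 0 /\ \max_d clock_in (ins t p d) = 0 by lia.
  rewrite idleP //; apply: det_step_idle => d.
  have := @leq_bigmax _ (fun d => clock_in (ins t p d)) d.
  rewrite i0 leqn0 insE; case: ifP => // h /eqP /= h0.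
  by rewrite idleP // !inE eqxx.
(* Each reading in sight is either 0 or the common one, so a nonzero maximum is the common one. *)
have cE : c = minn t.+1 T.+2.
  have [d hd] := @eq_bigmax _ (fun d => clock_in (ins t p d))
    ltac:(by apply/card_gt0P; exists (false, false)).
  have [hi|hi] := clk_in d; have [hs|[hs _ _]] := ok_p;
    move: c0; rewrite /c /max_clock hd hi hs //= /clock /=; lia.
have own_ok j : new_own (det t p) (ins t p) = Some j -> seg j = p.
  rewrite /new_own; case E: (own (det t p)) => [j'|].
    by move=> [<-]; case: ok_p => [h|[_ h _]]; [rewrite h in E | apply: h].
  case: pickP => // j' /existsP [d] + [<-].
  rewrite /located; case E1: (ins t p d) => [s|] //.
  case E2: (own s) => [j2|] // /eqP.
  have [p' hs [hp' hin]] := ok_in d s E1; rewrite hs in E2.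
  case: (IH p' hin) => [h|[_ h _]]; first by rewrite h in E2.
  by rewrite (h _ E2) hp' => /mv_injl.
right; rewrite /det_step -/c (negPf c0); split=> //.
  by rewrite /clock /= inordK cE; lia.
move=> j; rewrite /known /= !inE => /orP[/orP[h|/bigcupP[d _]]|/andP[/eqP h /eqP hb]].
- by case: ok_p => [e|[_ _ h']]; [rewrite e inE in h | exact: h'].
- case E: (ins t p d) => [s|]; last by rewrite inE.
  have [p' -> [_ hin]] := ok_in d s E => /= h.
  by case: (IH p' hin) => [e|[_ _ h']]; [rewrite e inE in h | exact: h'].
- by split; rewrite (own_ok _ h) // -(bits_ins t) hb (own_ok _ h).
Qed.

Lemma det_fire_sound t p : p \in l' -> det_fire (det t p) ->
  t = T /\ forall j, verified j.
Proof.
move=> hp /andP[/eqP h1 /eqP h2].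
have [e|[h _ h']] := detP t hp; first by rewrite e in h1.
split=> [|j]; first by lia.
by apply: h'; rewrite h2 inE.
Qed.

Lemma own_sound t p j : p \in l' -> own (det t p) = Some j -> seg j = p.
Proof.
by move=> hp h; case: (detP t hp) => [e|[_ h' _]]; [rewrite e in h | exact: h'].
Qed.

Lemma known_mono t p j : j \in known (det t p) -> j \in known (det t.+1 p).
Proof.
have -> : known (det t.+1 p) = new_known (det t p) (ins t p) by [].
by rewrite !inE => ->.
Qed.

Lemma known_nbr t p p' j : adjacent p p' -> p' \in l' ->
  j \in known (det t p') -> j \in known (det t.+1 p).
Proof.
case/adjacentP => d -> hin h.
have -> : known (det t.+1 p) = new_known (det t p) (ins t p) by [].
rewrite !inE -orbA orbCA.
apply/orP; left; apply/bigcupP; exists d => //.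
by rewrite /ins /nbrs hin.
Qed.

Hypothesis seg_inj : injective (fun j : 'I_n => seg j).

Lemma own_advance t (i j : 'I_n) :
  verified i -> seg j \in l' -> adjacent (seg i) (seg j) ->
  own (det t (seg j)) = Some j ->
  own (det t.+1 (seg i)) = Some i /\ i \in known (det t.+1 (seg i)).
Proof.
move=> [hi hb] hj /adjacentP [d hd] hown.
have E : own (det t.+1 (seg i)) = Some i.
  suff : isSome (own (det t.+1 (seg i))).
    case E: (own _) => [i'|] // _; congr Some; apply: seg_inj.
    exact: own_sound E.
  have -> : own (det t.+1 (seg i)) = new_own (det t (seg i)) (ins t (seg i)) by [].
  rewrite /new_own; case: (own (det t (seg i))) => [//|].
  case: pickP => // /(_ i) /existsP []; exists d.
  by rewrite /located /ins /nbrs -hd hj hown.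
split=> //.
have E' : new_own (det t (seg i)) (ins t (seg i)) = Some i by rewrite -E.
have -> : known (det t.+1 (seg i)) = new_known (det t (seg i)) (ins t (seg i)) by [].
by rewrite !inE E' eqxx bits_ins hb eqxx orbT.
Qed.

Section Spread.
Variables (k' m : nat).
Hypothesis cfg : is_config k' l'.
Hypothesis seg_at : forall j : 'I_n, cell_at l' (m + j) = seg j.
Hypothesis seg_in : m + n <= size l'.
Hypothesis all_verified : forall j, verified j.

Lemma seg_index (j : 'I_n) : m + j < size l'.
Proof. by apply: leq_trans seg_in; rewrite ltn_add2l. Qed.

Lemma seg_adjacent (i j : 'I_n) :
  (i.+1 == j) || (j.+1 == i) -> adjacent (seg i) (seg j).
Proof.
move=> h; rewrite -!seg_at (config_adjacent cfg) ?seg_index //; lia.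
Qed.

(** Indices pass from cell to cell along the segment, so node [j] is certain of itself as soon as a
    signal from the general can reach it. *)
Lemma known_self (j : 'I_n) t : t = (j - a) + (a - j) ->
  own (det t (seg j)) = Some j /\ j \in known (det t (seg j)).
Proof.
elim: t j => [|t IH] j ht.
  have -> : j = a by apply: val_inj => /=; lia.
  rewrite /det /= seg_a eqxx; split=> //=.
  by rewrite /known /=; have [_ ] := all_verified a; rewrite seg_a => ->; rewrite eqxx inE.
(* [i] is the neighbour of [j] one step nearer to the general. *)
have [i [hi1 hi2]] : exists i : 'I_n,
    t = (i - a) + (a - i) /\ ((j.+1 == i) || (i.+1 == j)).
  have jn := ltn_ord j; have an := ltn_ord a.
  have [h|h] := ltnP a j.
    have hj : j.-1 < n by lia.
    by exists (Ordinal hj) => /=; lia.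
  have hj : j.+1 < n by lia.
  by exists (Ordinal hj) => /=; lia.
have [h1 h2] := IH i hi1.
exact: own_advance (all_verified j) (proj1 (all_verified i)) (seg_adjacent hi2) h1.
Qed.

Lemma known_spread (j : 'I_n) t u x y :
  x < size l' -> y < size l' -> (x - y) + (y - x) <= u ->
  j \in known (det t (cell_at l' x)) ->
  j \in known (det (t + u) (cell_at l' y)).
Proof.
move=> hx hy + hk; elim: u y hy => [|u IH] y hy hu.
  by rewrite addn0 (_ : y = x) //; lia.
have [e|ne] := eqVneq x y.
  by rewrite addnS; apply: known_mono; apply: IH => //; lia.
rewrite addnS.
have [z [hz zu zy]] : exists z, [/\ z < size l', (x - z) + (z - x) <= u &
    (y.+1 == z) || (z.+1 == y)].
  have [h|h] := ltnP x y; [exists y.-1 | exists y.+1]; split; lia.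
apply: (@known_nbr _ _ (cell_at l' z)); last exact: IH.
  by rewrite (config_adjacent cfg).
exact: mem_nth.
Qed.

(** The hypothesis bounds the travel time from the general to [p_j] and from there to any node
    [y]. *)
Lemma det_fires :
  (forall (j : 'I_n) y, y < size l' ->
     (j - a) + (a - j) + ((m + j - y) + (y - (m + j))) <= T) ->
  forall p, p \in l' -> det_fire (det T p).
Proof.
move=> hT p hp; have [y hy yp] := nthP origin hp.
have full j : j \in known (det T p).
  have bound := hT j y hy.
  set d := (j - a) + (a - j) in bound.
  have -> : T = d + (T - d) by lia.
  rewrite -yp; apply: (@known_spread _ _ _ (m + j)) => //; first exact: seg_index.
    by lia.
  by rewrite seg_at; apply: (known_self _).2.
rewrite /det_fire; have -> : known (det T p) = setT.
  by apply/setP => j; rewrite full inE.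
rewrite eqxx andbT; case: (detP T hp) => [e|[-> _ _]]; last by lia.
by have := full a; rewrite e inE.
Qed.
End Spread.
End Array.
End Detector.

(** * The bound *)

Lemma least_nat (P : nat -> Prop) :
  (exists n, P n) -> exists n, P n /\ forall m, P m -> n <= m.
Proof.
move=> [n Pn]; have [m [Pm mmin]] : exists m, P m /\ forall j, j < m -> ~ P j.
  elim/ltn_ind: n Pn => n IH Pn.
  have [[j [jn Pj]]|none] := excluded_middle_informative (exists j, j < n /\ P j).
    exact: IH Pj.
  by exists n; split=> // j jn Pj; apply: none; exists j.
by exists m; split=> // j Pj; rewrite leqNgt; apply/negP => /mmin.
Qed.

Lemma esup_le (P : nat -> Prop) n : esup P = Fin n -> forall j, P j -> j <= n.
Proof.
rewrite /esup; case: excluded_middle_informative => // bdd [<-].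
exact: (epsilon_spec _ _ (least_nat bdd)).1.
Qed.

(** [mft] is chosen by [epsilon], so its specification requires that a minimum exist; the given
    solution provides a nonempty set of firing times. *)
Lemma mft_le A l t : is_solution A -> fires_at A l t -> mft l <= t.
Proof.
move=> solA At; have [n [[A' [solA' An]] nmin]] :=
  least_nat (ex_intro (fun n => exists A, is_solution A /\ fires_at A l n) t
    (ex_intro _ A (conj solA At))).
have mft_spec : is_mft l (mft l).
  apply: epsilon_spec; exists n; split; first by exists A'.
  by move=> B m solB Bm; apply: nmin; exists B.
exact: mft_spec.2 At.
Qed.

Lemma ele_foldr_emin (I : eqType) m (F : I -> enat) (s : seq I) :
  (forall i, i \in s -> ele (Fin m) (F i)) ->
  ele (Fin m) (foldr emin Inf (map F s)).
Proof.
elim: s => [|i s IH] //= h.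
have := h i (mem_head _ _); have : ele (Fin m) (foldr emin Inf (map F s)).
  by apply: IH => j hj; apply: h; rewrite inE hj orbT.
by case: (F i); case: (foldr _ _ _) => //= x y; rewrite leq_min => -> ->.
Qed.

(** * Configurations that contain the segment *)

Section Segment.
Variables (k : nat) (l : seq pos) (a b : nat).
Hypotheses (cfg : is_config k l) (ak : a <= k) (bs : b < size l - k).
Let seg := segment k l a b.

Lemma size_segment : size seg = (a + b).+1.
Proof. by rewrite /seg /segment size_drop size_takel; lia. Qed.

Lemma nth_segment i : i < (a + b).+1 -> cell_at seg i = cell_at l (k - a + i).
Proof. by move=> hi; rewrite /seg /segment nth_drop nth_take //; lia. Qed.

Lemma segment_uniq : uniq seg.
Proof. by rewrite /seg /segment drop_uniq // take_uniq //; case: cfg. Qed.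

Lemma segment_origin : cell_at seg a = origin.
Proof.
rewrite nth_segment; last by lia.
by rewrite subnK //; case: cfg.
Qed.

Lemma segment_adjacent i : i < a + b -> adjacent (cell_at seg i) (cell_at seg i.+1).
Proof.
move=> hi; rewrite !nth_segment; try lia.
by rewrite (config_adjacent cfg) ?addnS ?eqxx //; lia.
Qed.

Definition matches (l' : seq pos) : Prop :=
  forall q, q \in seg -> q \in l' /\ bc l' q = bc l q.

(** Consecutive cells of the segment have neighbouring indices in [l'], so the direction of the
    first step persists. *)
Lemma index_path k' l' : is_config k' l' -> {subset seg <= l'} ->
  (0 < a + b -> index (cell_at seg 1) l' = (index (cell_at seg 0) l').+1) ->
  forall i, i <= a + b -> index (cell_at seg i) l' = index (cell_at seg 0) l' + i.
Proof.
move=> cfg' sub dir1.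
have mem i : i <= a + b -> cell_at seg i \in l'.
  by move=> hi; apply/sub/mem_nth; rewrite size_segment.
have next i : i < a + b ->
    index (cell_at seg i.+1) l' = (index (cell_at seg i) l').+1 \/
    index (cell_at seg i) l' = (index (cell_at seg i.+1) l').+1.
  move=> hi; have hi' := ltnW hi; have := segment_adjacent hi.
  rewrite -(nth_index origin (mem i hi')) -(nth_index origin (mem i.+1 hi)).
  rewrite (config_adjacent cfg') ?index_mem ?mem //.
  by rewrite !nth_index ?mem // => /orP[] /eqP ->; [left | right].
have inj i j : i <= a + b -> j <= a + b ->
    index (cell_at seg i) l' = index (cell_at seg j) l' -> i = j.
  move=> hi hj h; have e : cell_at seg i = cell_at seg j.
    by rewrite -(nth_index origin (mem i hi)) h nth_index ?mem.
  by apply/eqP; rewrite -(nth_uniq origin _ _ segment_uniq) ?size_segment ?e.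
suff two i : i < a + b ->
    index (cell_at seg i) l' = index (cell_at seg 0) l' + i /\
    index (cell_at seg i.+1) l' = index (cell_at seg 0) l' + i.+1.
  case=> [|i] hi; first by rewrite addn0.
  exact: (two i hi).2.
elim: i => [|i IH] hi; first by rewrite addn0 addn1; split=> //; exact: dir1.
have [h1 h2] := IH (ltnW hi); split=> //.
have [->|h] := next i.+1 hi; first by rewrite h2 !addnS.
(* Turning back would give two distinct cells of the segment the same index. *)
have : i = i.+2 by apply: inj; lia.
lia.
Qed.

(** What the detector verifies is a property of a set of positions; this turns it into membership in
    [W], where [f] and [g] apply. *)
Lemma matches_W l' k' : is_config k' l' -> matches l' ->
  exists x0 x1, W k l a b x0 x1 /\ l' =i x0 ++ seg ++ x1.
Proof.
move=> cfg' hm.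
(* If [l'] runs through the segment backwards, its reversal is used instead. *)
wlog dir1 : k' l' cfg' hm /
    0 < a + b -> index (cell_at seg 1) l' = (index (cell_at seg 0) l').+1.
  move=> main.
  have mem i : i <= a + b -> cell_at seg i \in l'.
    by move=> hi; apply: (hm _ _).1; apply: mem_nth; rewrite size_segment.
  have [ab0|ab0] := posnP (a + b); first by apply: (main k' l') => //; lia.
  have := segment_adjacent ab0.
  rewrite -(nth_index origin (mem 0 isT)) -(nth_index origin (mem 1 ab0)).
  rewrite (config_adjacent cfg') ?index_mem ?mem //.
  case/orP => /eqP h; first exact: (main k' l').
  have hr : rev l' =i l' by move=> p; rewrite mem_rev.
  have idx p : p \in l' -> index p (rev l') = size l' - (index p l').+1.
    move=> hp; have hi : index p l' < size l' by rewrite index_mem.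
    have e : nth origin (rev l') (size l' - (index p l').+1) = p.
      rewrite nth_rev ?ltn_subrL ?(leq_ltn_trans _ hi) //.
      by rewrite subnSK // subKn ?nth_index // ltnW.
    rewrite -{1}e index_uniq ?rev_uniq ?size_rev //; last by case: cfg'.
    by rewrite ltn_subrL (leq_ltn_trans _ hi).
  have [||x0 [x1 [h1 h2]]] := main _ (rev l') (config_rev cfg').
  - by move=> q hq; rewrite (eq_bc _ hr) hr; exact: hm.
  - move=> _; rewrite !idx ?mem // -h.
    by rewrite subnSK // h index_mem mem.
  by exists x0, x1; split=> // p; rewrite -h2 hr.
have sub : {subset seg <= l'} by move=> q /hm [].
have ip := index_path cfg' sub dir1.
have [kl' l0' _ u' _] := cfg'.
set m := index (cell_at seg 0) l' in ip.
have lt i : i <= a + b -> m + i < size l'.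
  move=> hi; rewrite -ip // index_mem; apply/sub/mem_nth.
  by rewrite size_segment.
have split_l' : l' = take m l' ++ seg ++ drop (m + (a + b).+1) l'.
  rewrite -{1}(cat_take_drop m l'); congr cat.
  rewrite -{1}(cat_take_drop (a + b).+1 (drop m l')) drop_drop (addnC (a + b).+1); congr cat.
  have sz : size (take (a + b).+1 (drop m l')) = (a + b).+1.
    by rewrite size_takel // size_drop; have := lt (a + b) (leqnn _); lia.
  apply: (@eq_from_nth _ origin) => [|i]; rewrite sz ?size_segment // => hi.
  rewrite nth_take // nth_drop -ip // nth_index //; apply/sub/mem_nth.
  by rewrite size_segment.
have sm : size (take m l') = m by rewrite size_takel //; have := lt 0 isT; lia.
(* The origin occurs only once in [l'], so the general of [l'] is the one of the segment. *)
have k'E : k' = m + a.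
  rewrite -ip; last by lia.
  by rewrite segment_origin -l0' index_uniq.
exists (take m l'), (drop (m + (a + b).+1) l'); split; last by rewrite -split_l'.
rewrite /W -/seg -split_l' sm -k'E; split=> // q /hm [] //.
Qed.
End Segment.

(** * A solution and a detector run in parallel *)

Section Combine.
Variables (A : automaton) (n T : nat) (seg : nat -> pos) (a : 'I_n).
Variable want : pos -> bcond.

Let S := (St A * detector n T)%type.
Let comb_idle : S := (Qs A, idle n T).
Let comb_general (b : bcond) : S := (Gs (tau A b), det_general T a want b).
Let comb_step (s : S) (i : dir -> option S) : S :=
  let o d := omap fst (i d) in
  (delta s.1 (o (false, false)) (o (true, false)) (o (false, true)) (o (true, true)),
   det_step seg want s.2 (fun d => omap snd (i d))).
Let comb_fire (s : S) : bool := Fs s.1 || det_fire s.2.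

Let comb_idle_quiet : ~~ comb_fire comb_idle.
Proof. by rewrite /comb_fire (negPf (Q_notF A)). Qed.

Let comb_step_idle (i : dir -> option S) :
  (forall d, i d \in [:: Some comb_idle; None]) -> comb_step comb_idle i = comb_idle.
Proof.
move=> hi.
have h1 d : omap fst (i d) \in [:: Some (Qs A); None].
  by have := hi d; rewrite !inE => /orP[] /eqP -> //=; rewrite eqxx.
rewrite /comb_step Q_stable // det_step_idle // => d.
by have := hi d; rewrite !inE => /orP[] /eqP -> //=; rewrite eqxx.
Qed.

Lemma run_combine l' t p : run comb_idle comb_general comb_step l' t p =
  (state A l' t p, det T seg a want l' t p).
Proof.
elim: t p => [|t IH] p; first by rewrite /det /=; case: eqP.
rewrite /= IH /comb_step /=; congr pair.
  by rewrite /nbrs /= !(fun_if (omap _)) /= !IH.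
rewrite /det /= -/(det T seg a want l' t p); congr det_step.
apply: functional_extensionality => d.
by rewrite /nbrs; case: ifP => //= _; rewrite IH.
Qed.

Hypothesis seg_a : seg a = origin.

Hypothesis det_complete : forall k' l', is_config k' l' ->
  (forall j : 'I_n, verified seg want l' j) ->
  forall p, p \in l' -> det_fire (det T seg a want l' T p).

(** If [A] fires at [t0], the combination fires at [minn t0 T] when the whole segment is verified.
    Otherwise no detector ever fires, by soundness, and the time remains [t0]. *)
Lemma combine : is_solution A -> exists A', is_solution A' /\
  forall k' l', is_config k' l' -> (forall j : 'I_n, verified seg want l' j) ->
    exists2 t, t <= T & fires_at A' l' t.
Proof.
move=> solA; pose A' := automaton_of comb_general comb_idle_quiet comb_step_idle.
have run_fires l' t :
    fires_run (fun t p => Fs (state A l' t p) || det_fire (det T seg a want l' t p)) l' t ->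
    fires_at A' l' t.
  move=> [h1 h2]; apply: fires_automaton_of.
  by split=> [t' ht' p hp|p hp]; rewrite run_combine; [apply: h1 | apply: h2].
have early k' l' : is_config k' l' -> (forall j : 'I_n, verified seg want l' j) ->
    exists2 t, t <= T & fires_at A' l' t.
  move=> cfg hv; have [kl l0 _ _ _] := cfg.
  have l'0 : origin \in l' by rewrite -l0 mem_nth.
  have [t0 [h1 h2]] := solA _ _ cfg.
  exists (minn t0 T); first exact: geq_minr.
  apply: run_fires; split=> [t ht p hp|p hp].
    rewrite negb_or h1 //=; last by lia.
    by apply/negP => /(det_fire_sound seg_a l'0 hp) [tT _]; lia.
  by case: leqP => _; rewrite ?h2 ?(det_complete cfg) ?orbT.
exists A'; split=> // k' l' cfg.
have [hv|hv] := excluded_middle_informative (forall j : 'I_n, verified seg want l' j).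
  by have [t _ ht] := early _ _ cfg hv; exists t.
have [kl l0 _ _ _] := cfg.
have l'0 : origin \in l' by rewrite -l0 mem_nth.
have [t0 [h1 h2]] := solA _ _ cfg.
exists t0; apply: run_fires; split=> [t ht p hp|p hp]; last by rewrite h2.
rewrite negb_or h1 //=.
by apply/negP => /(det_fire_sound seg_a l'0 hp) [_ /hv].
Qed.
End Combine.

(** [f] and [g] limit every configuration in which the segment is verified, so [T] suffices for
    flooding in all of them, as the combined automaton needs in order to be a solution. *)
Lemma mft_le_pair k l a b f g : is_config k l -> a <= k -> b < size l - k ->
  (forall x0 x1, W k l a b x0 x1 -> size x0 <= f /\ size x1 <= g) ->
  mft l <= maxn (2 * a + b + g) (2 * b + a + f).
Proof.
move=> cfg ak bs bound; set T := maxn _ _.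
pose sg i := cell_at (segment k l a b) i.
pose n := (a + b).+1; pose a' : 'I_n := Ordinal (leq_addr b a : a < n).
have sz := size_segment ak bs.
have sg_a : sg a' = origin := segment_origin cfg ak bs.
have sg_inj : injective (fun j : 'I_n => sg j).
  move=> i j /eqP; rewrite nth_uniq ?sz //; last exact: segment_uniq cfg.
  by move/eqP/val_inj.
have vm l' : (forall j : 'I_n, verified sg (bc l) l' j) -> matches k l a b l'.
  move=> h q /(nthP origin)[i]; rewrite sz => hi <-.
  exact: h (Ordinal hi).
have fire k' l' : is_config k' l' -> (forall j : 'I_n, verified sg (bc l) l' j) ->
    forall p, p \in l' -> det_fire (det T sg a' (bc l) l' T p).
  move=> cfg' hv p hp.
  have [x0 [x1 [hW eql]]] := matches_W cfg ak bs cfg' (vm _ hv).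
  have [hf hg] := bound _ _ hW; have [cfgW bcW] := hW.
  (* The run depends only on the set of positions, so it may be studied on the list where the
     segment starts at index [size x0]. *)
  rewrite /det (eq_run _ _ _ eql) -/(det T sg a' (bc l) _ T p).
  set lW := x0 ++ _ in cfgW bcW eql *.
  have sizeW : size lW = size x0 + (n + size x1) by rewrite /lW !size_cat sz.
  have lW0 : origin \in lW.
    by case: cfgW => h1 h2 _ _ _; rewrite -h2 mem_nth.
  apply: (@det_fires n T sg a' (bc l) lW sg_a lW0 sg_inj _ (size x0) cfgW).
  - move=> j; rewrite /lW nth_cat ltnNge leq_addr /= addKn nth_cat sz.
    by rewrite (ltn_ord j).
  - by rewrite sizeW addnA leq_addr.
  - move=> j; have hj : sg j \in segment k l a b by rewrite mem_nth // sz.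
    split; last exact: bcW.
    by rewrite /lW !mem_cat hj orbT.
  (* The worst cases are [j = 0] with [y] the right end, costing [a + (a + b + g)], and [j = a + b]
     with [y] the left end, costing [b + (a + b + f)]. *)
  - move=> j y; rewrite sizeW /T /= => hy; have := ltn_ord j; rewrite /n in hy *.
    lia.
  - by rewrite -eql.
have [A solA] := solution_exists.
have [A' [solA' early]] := combine sg_a fire solA.
have [|t tT At] := early k l cfg; last exact: leq_trans (mft_le solA' At) tT.
move=> j; split=> //; rewrite /sg (nth_segment ak bs) ?ltn_ord //.
have jl : k - a + j < size l by have := ltn_ord j; rewrite /n; lia.
exact: mem_nth.
Qed.

Theorem theorem4 (k : nat) (l : seq pos) :
  is_config k l -> ele (Fin (mft l)) (Ttilde k l).
Proof.
move=> cfg; apply: ele_foldr_emin => -[a b] /allpairsP [[a0 b0] []].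
rewrite !mem_iota !add0n ltnS => /= ak bs [-> ->].
(* A pair with an infinite [f] or [g] contributes [Inf] and bounds nothing. *)
case E1: (g_fun _ _ _ _) => [g|] //=; case E2: (f_fun _ _ _ _) => [f|] //=.
apply: (mft_le_pair cfg) => // x0 x1 hW.
split; [apply: (esup_le E2) | apply: (esup_le E1)]; by exists x0, x1.
Qed.
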